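(* Let $p$ be an odd prime, let $G$ be a $p$-periodic graph on $n$ vertices, and let $\overline G$ be its quotient graph (which has $n/p$ vertices). Then $$U_G(x_1,\dots,x_n,y)\equiv U_{\overline G}(x_1,\dots,x_{n/p},y)$$ modulo the ideal of $\mathbb{Z}[x_1,\dots,x_n,y]$ generated by $p$, $y^p-y$, and the elements $x_k^p-x_k$ and $x_{pk}-x_k$ for all $k$ (for which these variables occur).
   Context: Here a graph $G$ is a finite graph with vertex set $V$ ($|V|=n$) and edge set $E$, possibly with multiple edges and loops. For $A\subseteq E$, $G|A$ denotes the spanning subgraph $(V,A)$, $k(G|A)$ its number of connected components, and $r(A)=n-k(G|A)$ its rank. With commuting indeterminates $x_1,\dots,x_n,y$, define $$U_G(x_1,\dots,x_n,y)=\sum_{A\subseteq E} x_{n_1}x_{n_2}\cdots x_{n_k}\,(y-1)^{|A|-r(A)},$$ where $n_1,\dots,n_k$ are the numbers of vertices of the connected components of $G|A$. For an integer $p\ge2$, $G$ is $p$-periodic if it has an automorphism $h$ (a permutation of vertices and edges preserving incidence) with $h^p=\mathrm{Id}$ and $h^i(v)\ne v$ for every vertex $v$ and every $1\le i\le p-1$. The quotient graph $\overline G$ has as vertices the orbits of $V$ under $\langle h\rangle$ and as edges the orbits of $E$ under $\langle h\rangle$, an edge orbit joining the vertex orbits containing the endpoints of its edges. *)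

(* Defs.v *)
From HB Require Import structures.
From mathcomp Require Import all_boot all_order all_fingroup all_algebra.
From mathcomp Require Import mpoly.

Set Implicit Arguments.
Unset Strict Implicit.
Unset Printing Implicit Defensive.

Import GRing.Theory.
Local Open Scope ring_scope.

(* Finite graphs with multiple edges and loops; an edge with a single endpoint
   is a loop. *)
Record mgraph := Mgraph {
  vert : finType;
  edge : finType;
  ends : edge -> {set vert};
  ends_card : forall e : edge, (0 < #|ends e| <= 2)%N
}.

Section Invariant.
Variable G : mgraph.
Implicit Type A : {set edge G}.

Definition adj A : rel (vert G) :=
  fun u v => [exists e in A, (u \in ends e) && (v \in ends e)].

Definition components A : {set {set vert G}} :=
  equivalence_partition (connect (adj A)) [set: vert G].

Definition rank A : nat := (#|vert G| - #|components A|)%N.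

End Invariant.

(* In {mpoly int[n.+1]}, the variables of index 0, ..., n.-1 play the roles of
   x_1, ..., x_n and the last one that of y.  [xvar n k] is meaningful only for
   0 < k <= n. *)
Definition xvar (n k : nat) : {mpoly int[n.+1]} := 'X_(inord k.-1).
Definition yvar (n : nat) : {mpoly int[n.+1]} := 'X_ord_max.

(* The natural subtraction never truncates: the rank of A is at most #|A|. *)
Definition U (G : mgraph) : {mpoly int[#|vert G|.+1]} :=
  \sum_(A : {set edge G})
    (\prod_(C in components A) xvar #|vert G| #|C|)
    * (yvar #|vert G| - 1) ^+ (#|A| - rank A).

(* For m <= n, the inclusion of Z[x_1..x_m, y] in Z[x_1..x_n, y]. *)
Definition incl (m n : nat) (f : {mpoly int[m.+1]}) : {mpoly int[n.+1]} :=
  f \mPo [tuple if (i < m)%N then xvar n i.+1 else yvar n | i < m.+1].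

Record automorphism (G : mgraph) := Automorphism {
  autv : {perm vert G};
  aute : {perm edge G};
  aut_incidence : forall v e, (autv v \in ends (aute e)) = (v \in ends e)
}.

Definition periodic_by (p : nat) (G : mgraph) (h : automorphism G) : Prop :=
  [/\ (autv h ^+ p)%g = 1%g,
      (aute h ^+ p)%g = 1%g &
      forall (v : vert G) (i : nat),
        (1 <= i <= p.-1)%N -> (autv h ^+ i)%g v != v].

Section Quotient.
Variables (G : mgraph) (h : automorphism G).

Definition qvert : finType := {W : {set vert G} | W \in porbits (autv h)}.
Definition qedge : finType := {O : {set edge G} | O \in porbits (aute h)}.

Definition qends (O : qedge) : {set qvert} :=
  [set W : qvert | [exists e in val O, exists v in ends e, v \in val W]].

Fact vorbit_in (v : vert G) : porbit (autv h) v \in porbits (autv h).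
Proof. exact: imset_f. Qed.

Definition vorbit (v : vert G) : qvert := Sub (porbit (autv h) v) (vorbit_in v).

Lemma aut_incidenceX (i : nat) (v : vert G) (e : edge G) :
  ((autv h ^+ i)%g v \in ends ((aute h ^+ i)%g e)) = (v \in ends e).
Proof.
elim: i => [|i IHi]; first by rewrite !expg0 !perm1.
by rewrite !expgSr !permM aut_incidence.
Qed.

Lemma qendsE (O : qedge) (e : edge G) :
  val O = porbit (aute h) e -> qends O = vorbit @: ends e.
Proof.
move=> OE; apply/setP=> W; rewrite inE OE.
have [w WE] : exists w, val W = porbit (autv h) w.
  by case/imsetP: (valP W) => w _ ->; exists w.
apply/existsP/imsetP => [[e' /andP[/porbitP[i ->]]]|[v ve ->]].
  move=> /existsP[v /andP[ve vW]]; exists ((autv h ^+ i)^-1%g v).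
    by rewrite -(aut_incidenceX i) permKV.
  apply: val_inj; rewrite /= WE.
  move: vW; rewrite WE -eq_porbit_mem => /eqP <-.
  by rewrite -[X in porbit _ X = _](permKV (autv h ^+ i)%g v) porbit_perm.
exists e; rewrite porbit_id /=; apply/existsP; exists v.
by rewrite ve porbit_id.
Qed.

Lemma qends_card (O : qedge) : (0 < #|qends O| <= 2)%N.
Proof.
have [e _ OE] := imsetP (valP O).
rewrite (qendsE OE) card_gt0 imset_eq0 -card_gt0.
have /andP[-> le2] := ends_card e.
exact: leq_trans (leq_imset_card _ _) le2.
Qed.

Definition quotient_graph : mgraph := Mgraph qends_card.

End Quotient.

(* Membership in the ideal generated by the set S. *)
Definition in_ideal (R : comNzRingType) (S : R -> Prop) (f : R) : Prop :=
  exists2 s : seq (R * R),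
    forall c, c \in s -> S c.2 & f = \sum_(c <- s) c.1 * c.2.

Definition relations (p n : nat) (g : {mpoly int[n.+1]}) : Prop :=
  [\/ g = p%:R,
      g = yvar n ^+ p - yvar n,
      exists2 k : nat, (1 <= k <= n)%N & g = xvar n k ^+ p - xvar n k |
      exists2 k : nat, (1 <= k)%N && (p * k <= n)%N &
        g = xvar n (p * k) - xvar n k].

(* Main.v *)
Require Import Defs.
From mathcomp Require Import all_boot all_order all_fingroup all_algebra.
From mathcomp Require Import cyclic mpoly zify.

(* The automorphism h acts on the edge sets A, and its orbits of size p cancel
   modulo p; the invariant sets are the pullbacks of edge sets B of the quotient
   (as p > 2, no edge is fixed, so |A| = p|B|).  The nullity |A| - r(A) is the sum
   over the components C of G|A of e(C) + 1 - |C|, so each term of U is a product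
   over components of x_|C| (y-1)^(e(C)+1-|C|).  Over a component D of the quotient
   lie either p translates of one component with |C| = |D| and e(C) = e(D), and
   the Frobenius relations x^p = x, (y-1)^p = y-1 apply, or a single invariant C
   with |C| = p|D| and e(C) = p e(D).  In the latter case e(C) + 1 >= |C| forces
   e(D) >= |D|, so that the exponents p(e(D)-|D|) + 1 and (e(D)-|D|) + 1 may be
   exchanged, and x_(p|D|) = x_|D|. *)

Set Implicit Arguments.
Unset Strict Implicit.
Unset Printing Implicit Defensive.

Import GRing.Theory.
Local Open Scope ring_scope.

(** * Orbits of a permutation whose order divides a prime *)

Lemma card_porbit_prime (T : finType) (s : {perm T}) p x :
    prime p -> (s ^+ p)%g = 1%g ->
  #|porbit s x| = (if s x == x then 1 else p)%N.
Proof.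
move=> p_pr sp; case: eqP => [sx|/eqP sx].
  apply/eqP/cards1P; exists x; apply/setP=> y; rewrite inE.
  apply/porbitP/eqP => [[i ->]|->]; last by exists 0; rewrite perm1.
  by elim: i => [|i IHi]; rewrite ?perm1 // expgSr permM IHi.
have : (#|porbit s x| %| p)%N.
  rewrite porbitE; apply: dvdn_trans (dvdn_orbit _ _ _) _.
  by rewrite -/(#[s])%g order_dvdn sp.
case/primeP: p_pr => _ p_div /p_div/orP[|/eqP//]; case/cards1P=> y xE.
have:= porbit_id s x; rewrite xE inE => /eqP xy.
by have:= mem_porbit s 1 x; rewrite expg1 xE inE -xy (negPf sx).
Qed.

Lemma partition_big_porbit (A : Type) (idx : A) (op : Monoid.com_law idx)
    (T : finType) (s : {perm T}) (P : pred T) F :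
  \big[op/idx]_(x | P x) F x =
    \big[op/idx]_(O in porbits s) \big[op/idx]_(x in O | P x) F x.
Proof.
rewrite (partition_big (porbit s) (mem (porbits s))) => [|x _]; last exact: imset_f.
apply: eq_bigr => _ /imsetP[x _ ->]; apply: eq_bigl => y.
by rewrite andbC eq_porbit_mem porbit_sym.
Qed.

(** * Congruence modulo the ideal generated by a set *)

Section Congruence.
Variables (R : comNzRingType) (S : R -> Prop).
Implicit Types f g : R.

Lemma in_ideal0 : in_ideal S 0.
Proof. by exists [::]; rewrite ?big_nil. Qed.

Lemma in_idealD f g : in_ideal S f -> in_ideal S g -> in_ideal S (f + g).
Proof.
move=> [s sS ->] [t tS ->]; exists (s ++ t); last by rewrite big_cat.
by move=> c; rewrite mem_cat => /orP[/sS|/tS].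
Qed.

Lemma in_idealM f g : in_ideal S g -> in_ideal S (f * g).
Proof.
move=> [s sS ->]; exists [seq (f * c.1, c.2) | c <- s].
  by move=> _ /mapP[c /sS cS ->].
by rewrite big_map mulr_sumr; apply: eq_bigr => c _; rewrite mulrA.
Qed.

Lemma in_ideal_gen f : S f -> in_ideal S f.
Proof.
move=> Sf; exists [:: (1, f)]; last by rewrite big_seq1 mul1r.
by move=> c; rewrite inE => /eqP->.
Qed.

Definition congr_mod f g := in_ideal S (f - g).

Lemma congr_refl f : congr_mod f f.
Proof. by rewrite /congr_mod subrr; apply: in_ideal0. Qed.

Lemma congr_trans g f k : congr_mod f g -> congr_mod g k -> congr_mod f k.
Proof.
by rewrite /congr_mod => fg gk; rewrite -(subrKA g); apply: in_idealD.
Qed.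

Lemma congrD f f' g g' :
  congr_mod f f' -> congr_mod g g' -> congr_mod (f + g) (f' + g').
Proof.
by rewrite /congr_mod => ff gg; rewrite opprD addrACA; apply: in_idealD.
Qed.

Lemma congrM f f' g g' :
  congr_mod f f' -> congr_mod g g' -> congr_mod (f * g) (f' * g').
Proof.
rewrite /congr_mod => ff gg.
have -> : f * g - f' * g' = f * (g - g') + g' * (f - f').
  by rewrite !mulrBr ![g' * _]mulrC subrKA.
by apply: in_idealD; apply: in_idealM.
Qed.

Lemma congrX f g n : congr_mod f g -> congr_mod (f ^+ n) (g ^+ n).
Proof.
move=> fg; elim: n => [|n IHn]; first exact: congr_refl.
by rewrite !exprS; apply: congrM.
Qed.

Lemma congr_sum I (r : seq I) (P : pred I) F F' :
    (forall i, P i -> congr_mod (F i) (F' i)) ->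
  congr_mod (\sum_(i <- r | P i) F i) (\sum_(i <- r | P i) F' i).
Proof.
by move=> FF; apply: big_ind2 => //; [apply: congr_refl | move=> *; apply: congrD].
Qed.

Lemma congr_prod I (r : seq I) (P : pred I) F F' :
    (forall i, P i -> congr_mod (F i) (F' i)) ->
  congr_mod (\prod_(i <- r | P i) F i) (\prod_(i <- r | P i) F' i).
Proof.
by move=> FF; apply: big_ind2 => //; [apply: congr_refl | move=> *; apply: congrM].
Qed.

Lemma congr_mulrn0 p m f : S p%:R -> (p %| m)%N -> congr_mod (f *+ m) 0.
Proof.
move=> Sp /dvdnP[q ->]; rewrite /congr_mod subr0 mulnC mulrnA.
by rewrite -mulr_natr -[_ *+ p]mulr_natr -mulrA [_ * q%:R]mulrC mulrA;
   apply/in_idealM/in_ideal_gen.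
Qed.

(** Frobenius: the prime [p] divides every interior binomial coefficient. *)
Lemma congr_exprD p f g : prime p -> S p%:R ->
  congr_mod ((f + g) ^+ p) (f ^+ p + g ^+ p).
Proof.
case: p => [//|p] p_pr Sp.
rewrite exprDn big_ord_recl big_ord_recr /= bin0 binn subn0 subnn.
rewrite !expr0 mulr1 mul1r !mulr1n.
apply: congrD; first exact: congr_refl.
rewrite -[X in congr_mod _ X]add0r; apply: congrD; last exact: congr_refl.
apply: (big_ind (fun z => congr_mod z 0)) => [|x y x0 y0|i _].
- exact: congr_refl.
- by rewrite -[0]addr0; apply: congrD.
apply: congr_mulrn0 Sp _; apply: prime_dvd_bin => //.
by rewrite /bump /= add1n ltnS ltn_ord.
Qed.

(** [F] is constant on each orbit, and an orbit of non-fixed points has [p] elements, so it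
    contributes a multiple of [p]. *)
Lemma congr_sum_fixed (T : finType) (s : {perm T}) p (F : T -> R) :
    prime p -> (s ^+ p)%g = 1%g -> S p%:R -> (forall x, F (s x) = F x) ->
  congr_mod (\sum_x F x) (\sum_(x | s x == x) F x).
Proof.
move=> p_pr sp Sp Fs.
rewrite (partition_big_porbit _ s predT) (partition_big_porbit _ s (fun x => s x == x)).
apply: congr_sum => _ /imsetP[x _ ->].
have FX y : y \in porbit s x -> F y = F x /\ (s y == y) = (s x == x).
  case/porbitP=> i ->; elim: i => [|i [IHF IHs]]; first by rewrite perm1.
  by rewrite expgSr permM Fs (inj_eq perm_inj).
have [sx|/negPf sx] := boolP (s x == x).
  rewrite (eq_bigl (fun y => (y \in porbit s x) && (s y == y))); first exact: congr_refl.
  by move=> y; rewrite andbT; case: (boolP (y \in _)) => //= /FX[_ ->].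
(* On a non-trivial orbit the right-hand sum is empty and the left-hand one is [p] times [F x]. *)
rewrite [X in congr_mod _ X]big_pred0 => [|y]; last first.
  by case: (boolP (y \in _)) => //= /FX[_ ->].
rewrite (eq_bigr (fun=> F x)) => [|y /andP[/FX[]//]].
rewrite big_andbC /= sumr_const; apply: congr_mulrn0 Sp _.
rewrite (card_porbit_prime x p_pr sp) sx //.
Qed.

End Congruence.

(** * Connectivity, components and nullity *)

Lemma homo_connect (T T' : finType) (e : rel T) (e' : rel T') (k : T -> T') :
    (forall u v, e u v -> connect e' (k u) (k v)) ->
  forall u v, connect e u v -> connect e' (k u) (k v).
Proof.
move=> ke u _ /connectP[s us ->].
elim: s u us => [|w s IHs] u //= /andP[/ke uw /IHs]; exact: connect_trans.
Qed.

Section Components.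
Variable G : mgraph.
Implicit Types (A : {set edge G}) (C D : {set vert G}) (u v w : vert G).

Lemma adj_connect_sym A : connect_sym (adj A).
Proof.
apply: sym_connect_sym => u v.
by apply: eq_existsb => e; rewrite [(u \in _) && _]andbC.
Qed.

Definition component A v : {set vert G} := [set w | connect (adj A) v w].

Lemma mem_component A v w : (w \in component A v) = (component A v == component A w).
Proof.
rewrite inE; apply/idP/eqP => [vw|vwE].
  by apply/setP=> x; rewrite !inE (same_connect (@adj_connect_sym A) vw).
by have := connect0 (adj A) w; have /setP/(_ w) := vwE; rewrite !inE => ->.
Qed.

Lemma component_id A v : v \in component A v.
Proof. by rewrite mem_component. Qed.

Lemma componentsE A : components A = component A @: [set: vert G].
Proof.
by apply: eq_in_imset => v _; apply/setP=> w; rewrite !inE.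
Qed.

Lemma component_in A v : component A v \in components A.
Proof. by rewrite componentsE imset_f. Qed.

Lemma componentsP A C :
  reflect (exists v, C = component A v) (C \in components A).
Proof.
rewrite componentsE; apply: (iffP imsetP) => [[v _ ->]|[v ->]]; exists v => //.
Qed.

Lemma mem_in_components A C v :
  C \in components A -> (v \in C) = (component A v == C).
Proof. by case/componentsP=> w ->; rewrite mem_component eq_sym. Qed.

Lemma adj_component A e u v :
  e \in A -> u \in ends e -> v \in ends e -> component A u = component A v.
Proof.
move=> eA ue ve; apply/eqP; rewrite -mem_component inE.
by apply/connect1/existsP; exists e; rewrite eA ue ve.
Qed.

Definition inner_edges A D := [set e in A | ends e \subset D].

Lemma ends_witness (e : edge G) : exists u, u \in ends e.
Proof. by apply/set0Pn; rewrite -card_gt0; case/andP: (ends_card e). Qed.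

(** All endpoints of an edge of [A] lie in one component, so a single endpoint [u] decides whether
    the whole edge is inside [C]. *)
Lemma mem_inner_edges A C e u : e \in A -> C \in components A -> u \in ends e ->
  (e \in inner_edges A C) = (component A u == C).
Proof.
move=> eA Cc ue; rewrite inE eA -(mem_in_components _ Cc) /=.
apply/subsetP/idP => [->//|uC w we].
by move: uC; rewrite !(mem_in_components _ Cc) (adj_component eA ue we).
Qed.

(* A set D around v that maximises its size under this bound is closed under
   adjacency: an edge leaving D would add one vertex and at least one edge. *)
Lemma card_component_le A v :
  (#|component A v| <= #|inner_edges A (component A v)|.+1)%N.
Proof.
pose P D := [&& v \in D, D \subset component A v & #|D| <= #|inner_edges A D|.+1]%N.
have P1 : P [set v] by rewrite /P inE eqxx cards1 sub1set component_id.
have [D /maxsetP[/and3P[vD sD leD] maxD] _] := maxset_exists P1.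
suff /eqP <- : D == component A v by [].
rewrite eqEsubset sD /=; apply/subsetP=> w; rewrite inE.
have clD : closed (adj A) (mem D).
  apply: intro_closed (@adj_connect_sym A) _ _ => x y /existsP[e /and3P[eA xe ye]] xD.
  apply/idPn=> yD; have {}yD : y \notin D := yD; pose D' := y |: D; case/negP: (yD).
  suff <- : D' = D by rewrite setU11.
  apply: maxD; last exact: subsetUr.
  have xy : x != y by apply: contraNneq yD => <-.
  (* An edge has at most two endpoints, so [x] and [y] exhaust those of [e]; hence [e] is inside
     [D'] but, as [y] is new, not inside [D]. *)
  have eE : ends e = [set x; y].
    apply/esym/eqP; rewrite eqEcard subUset !sub1set xe ye cards2 xy.
    by case/andP: (ends_card e).
  apply/and3P; split; first by rewrite !inE vD orbT.
    rewrite subUset sD sub1set andbT.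
    by rewrite mem_component -(adj_component eA xe ye) -mem_component (subsetP sD).
  rewrite cardsU1 yD ltnS; apply: leq_trans leD _.
  apply: (@leq_trans #|e |: inner_edges A D|).
    rewrite cardsU1 inE eA eE subUset !sub1set /=.
    by rewrite (negPf yD) andbF.
  apply/subset_leq_card/subsetP=> e'; rewrite !inE => /predU1P[->|/andP[-> se]].
    by rewrite eA eE; apply/subsetP=> z; rewrite !inE => /orP[]/eqP->; rewrite ?eqxx ?xD ?orbT.
  by rewrite (subset_trans se) ?subsetUr.
by move/(closed_connect clD) => <-.
Qed.

(** The hypothesis makes [D] a union of components; it serves for the whole vertex set and for the
    preimage of a component of the quotient. *)
Lemma card_components_sum A D : (forall v, v \in D -> component A v \subset D) ->
  (#|D| = \sum_(C in components A | C \subset D) #|C|)%N.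
Proof.
move=> clD; rewrite -sum1_card.
rewrite (partition_big (component A) (fun C => (C \in components A) && (C \subset D))).
  apply: eq_bigr => C /andP[Cc sC]; rewrite -sum1_card; apply: eq_bigl => v.
  rewrite -(mem_in_components _ Cc) andbC; case: (boolP (v \in C)) => //=.
  by move/(subsetP sC).
by move=> v vD; rewrite component_in clD.
Qed.

(** Double count: each edge of [A] inside [D] lies in exactly one component, that of any of its
    endpoints. *)
Lemma card_inner_edges_sum A D : (forall v, v \in D -> component A v \subset D) ->
  (#|inner_edges A D|
    = \sum_(C in components A | C \subset D) #|inner_edges A C|)%N.
Proof.
move=> clD; under [RHS]eq_bigr do rewrite -sum1_card.
rewrite (exchange_big_dep (mem (inner_edges A D))) /=.
  rewrite -sum1_card; apply: eq_bigr => e eD.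
  have [u ue] := ends_witness e.
  have [eA sD] : e \in A /\ ends e \subset D by apply/andP; rewrite inE in eD.
  rewrite (big_pred1 (component A u)) // => C /=.
  case: (boolP (C \in components A)) => Cc /=.
    rewrite (mem_inner_edges eA Cc ue) eq_sym andbC.
    by case: eqP => //= ->; rewrite clD // (subsetP sD).
  by apply/esym/eqP => CE; rewrite CE component_in in Cc.
move=> C e /andP[_ sC]; rewrite !inE => /andP[-> sE].
by rewrite (subset_trans sE).
Qed.

Lemma nullity_sum A :
  (#|A| - rank A = \sum_(C in components A) (#|inner_edges A C|.+1 - #|C|))%N.
Proof.
have clT v : v \in [set: vert G] -> component A v \subset [set: vert G].
  by rewrite subsetT.
(* This bound makes the natural subtractions in the sum exact; [kn] does the same for the one in
   [rank]. *)
have leC C : C \in components A -> (#|C| <= #|inner_edges A C|.+1)%N.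
  by case/componentsP=> v ->; apply: card_component_le.
have nE := card_components_sum clT; have eE := card_inner_edges_sum clT.
have iE : inner_edges A [set: vert G] = A by apply/setP=> e; rewrite inE subsetT andbT.
have kn : (#|components A| <= #|vert G|)%N.
  by rewrite componentsE -cardsT; apply: leq_imset_card.
have sE : (\sum_(C in components A) (#|inner_edges A C|.+1 - #|C|)
     + \sum_(C in components A) #|C|
   = \sum_(C in components A) #|inner_edges A C| + #|components A|)%N.
  rewrite -big_split /= -sum1_card -big_split /=; apply: eq_bigr => C /leC.
  by lia.
have eqT F : (\sum_(C in components A | C \subset [set: vert G]) F C
   = \sum_(C in components A) F C)%N.
  by apply: eq_bigl => C; rewrite subsetT andbT.
rewrite !eqT iE in nE eE; rewrite -nE -eE cardsT in sE.
by rewrite /rank; lia.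
Qed.

(** The factor that one component contributes to a term of U, with [z] standing for y - 1. The
    exponent is the nullity of the component; adding 1 before subtracting keeps it exact, by
    [card_component_le]. *)
Definition weight (R : comNzRingType) (x : nat -> R) (z : R) A C :=
  x #|C| * z ^+ (#|inner_edges A C|.+1 - #|C|).

Lemma prod_weight (R : comNzRingType) (x : nat -> R) (z : R) A :
  \prod_(C in components A) weight x z A C
    = (\prod_(C in components A) x #|C|) * z ^+ (#|A| - rank A).
Proof. by rewrite big_split /= nullity_sum -expr_sum. Qed.

End Components.

(** * U as a sum of products of component weights *)

(** [incl] is a bare function; identifying it with a ring morphism lets [incl_U] push it through
    sums, products and powers. *)
Lemma incl_is_rmorphism m n : {f : {rmorphism {mpoly int[m.+1]} -> {mpoly int[n.+1]}} |
  f =1 @incl m n}.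
Proof. by rewrite /incl; eexists (comp_mpoly _) => x. Qed.

Lemma incl_xvar m n k : (0 < k <= m)%N -> incl n (xvar m k) = xvar n k.
Proof.
move=> /andP[k0 km]; have k1m : (k.-1 < m)%N by rewrite prednK.
rewrite /incl /xvar comp_mpolyXU -tnth_nth tnth_mktuple.
by rewrite inordK ?k1m ?prednK // leqW.
Qed.

Lemma incl_yvar m n : incl n (yvar m) = yvar n.
Proof.
by rewrite /incl /yvar comp_mpolyXU -tnth_nth tnth_mktuple ltnn.
Qed.

Lemma incl_U (G : mgraph) n :
  incl n (U G) = \sum_(A : {set edge G})
    \prod_(C in components A) weight (xvar n) (yvar n - 1) A C.
Proof.
have [f fE] := incl_is_rmorphism #|vert G| n.
rewrite -fE /U rmorph_sum; apply: eq_bigr => A _.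
rewrite prod_weight rmorphM rmorphXn rmorphB rmorph1 rmorph_prod /= fE incl_yvar.
congr (_ * _); apply: eq_bigr => C /componentsP[v ->]; rewrite fE incl_xvar //.
(* The range condition of [incl_xvar]: a component is non-empty and has at most [#|vert G|]
   vertices. *)
by rewrite max_card andbT; apply/card_gt0P; exists v; apply: component_id.
Qed.

Lemma U_weight (G : mgraph) :
  U G = \sum_(A : {set edge G})
    \prod_(C in components A) weight (xvar #|vert G|) (yvar #|vert G| - 1) A C.
Proof. by apply: eq_bigr => A _; rewrite prod_weight. Qed.

(** * The action of a permutation on subsets *)

Section ImsetPerm.
Variables (T : finType) (s : {perm T}).

(** Packaged as a permutation so that the orbit lemmas apply both to edge sets and to components. *)
Definition imset_perm : {perm {set T}} := perm (imset_inj (@perm_inj T s)).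

Lemma imset_permX i (A : {set T}) : (imset_perm ^+ i)%g A = (s ^+ i)%g @: A.
Proof.
elim: i A => [|i IHi] A.
  by rewrite !expg0 perm1 (eq_imset _ (@perm1 T)) imset_id.
rewrite !expgSr permM IHi permE -imset_comp.
by apply: eq_imset => x; rewrite /= permM.
Qed.

Lemma imset_perm_exp1 p : (s ^+ p)%g = 1%g -> (imset_perm ^+ p)%g = 1%g.
Proof.
move=> sp; apply/permP=> A; rewrite imset_permX sp perm1.
by rewrite (eq_imset _ (@perm1 T)) imset_id.
Qed.

End ImsetPerm.

Lemma card_preimset_const (T T' : finType) (k : T -> T') (B : {set T'}) m :
  (forall y, y \in B -> #|[set x | k x == y]| = m) -> (#|k @^-1: B| = #|B| * m)%N.
Proof.
move=> km; rewrite -sum1_card (partition_big k (mem B)) => [|x]; last by rewrite inE.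
rewrite -sum_nat_const; apply: eq_bigr => y yB; rewrite -(km y yB) -sum1_card.
by apply: eq_bigl => x; rewrite !inE andbC; case: eqP => // ->.
Qed.

(** * The action of an automorphism and the quotient graph *)

Section Automorphism.
Variables (G : mgraph) (h : automorphism G).
Implicit Types (A : {set edge G}) (C D : {set vert G}) (e : edge G) (u v w : vert G).
Local Notation g := (autv h).
Local Notation f := (aute h).

Lemma ends_aut e : ends (f e) = g @: ends e.
Proof.
apply/setP=> v; apply/idP/imsetP => [vfe|[u ue ->]]; last by rewrite aut_incidence.
by exists (g^-1%g v); rewrite ?permKV // -(aut_incidence h) permKV.
Qed.

Lemma adj_aut A u v : adj (f @: A) (g u) (g v) = adj A u v.
Proof.
apply/existsP/existsP => [[_ /andP[/imsetP[e eA ->]]]|[e /andP[eA uve]]].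
  by rewrite !aut_incidence => uve; exists e; rewrite eA.
by exists (f e); rewrite imset_f // !aut_incidence.
Qed.

Lemma component_aut A v : component (f @: A) (g v) = g @: component A v.
Proof.
have adjV x y : connect (adj (f @: A)) x y -> connect (adj A) (g^-1%g x) (g^-1%g y).
  by apply: homo_connect => {}x {}y xy; apply: connect1; rewrite -adj_aut !permKV.
apply/setP=> w; rewrite -[w](permKV g) (mem_imset _ _ perm_inj) !inE.
apply/idP/idP; last by apply: homo_connect => x y; rewrite -(adj_aut A) => /connect1.
by move/adjV; rewrite !permK.
Qed.

Lemma components_aut A : components (f @: A) = imset_perm g @: components A.
Proof.
apply/setP=> C; apply/componentsP/imsetP => [[v ->]|[_ /componentsP[v ->] ->]].
  exists (component A (g^-1%g v)); first exact: component_in.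
  by rewrite permE -component_aut permKV.
by exists (g v); rewrite permE component_aut.
Qed.

Lemma inner_edges_aut A D : inner_edges (f @: A) (g @: D) = f @: inner_edges A D.
Proof.
apply/setP=> e; rewrite -[e](permKV f) (mem_imset _ _ perm_inj) !inE.
rewrite (mem_imset _ _ perm_inj) ends_aut; congr (_ && _).
apply/subsetP/subsetP => [sD x xe|sD _ /imsetP[x xe ->]]; last by rewrite imset_f // sD.
by rewrite -(mem_imset _ _ (@perm_inj _ g)) sD // imset_f.
Qed.

Lemma weight_aut (R : comNzRingType) (x : nat -> R) z A D :
  weight x z (f @: A) (g @: D) = weight x z A D.
Proof. by rewrite /weight inner_edges_aut !card_imset //; apply: perm_inj. Qed.

(** The invariance that [congr_sum_fixed] requires: [h] matches the components of [A] with those of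
    its image and preserves weights. *)
Lemma prod_weight_aut (R : comNzRingType) (x : nat -> R) z A :
  \prod_(C in components (f @: A)) weight x z (f @: A) C
    = \prod_(C in components A) weight x z A C.
Proof.
rewrite components_aut big_imset /=; last by move=> ? ? _ _; apply: perm_inj.
by apply: eq_bigr => C _; rewrite permE weight_aut.
Qed.

Fact eorbit_in e : porbit f e \in porbits f.
Proof. exact: imset_f. Qed.

Definition eorbit e : edge (quotient_graph h) := Sub (porbit f e) (eorbit_in e).
Definition vproj v : vert (quotient_graph h) := vorbit h v.

Lemma eorbitP (O : edge (quotient_graph h)) : exists e, O = eorbit e.
Proof. by have [e _ OE] := imsetP (valP O); exists e; apply: val_inj. Qed.

Lemma vprojP (W : vert (quotient_graph h)) : exists v, W = vproj v.
Proof. by have [v _ WE] := imsetP (valP W); exists v; apply: val_inj. Qed.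

Lemma ends_eorbit e : ends (eorbit e) = vproj @: ends e.
Proof. exact: qendsE. Qed.

Lemma eq_eorbit e e' : (eorbit e == eorbit e') = (e \in porbit f e').
Proof. by rewrite -val_eqE /= eq_porbit_mem. Qed.

Lemma eq_vproj u v : (vproj u == vproj v) = (u \in porbit g v).
Proof. by rewrite -val_eqE /= eq_porbit_mem. Qed.

Lemma vprojX i v : vproj ((g ^+ i)%g v) = vproj v.
Proof. by apply/eqP; rewrite eq_vproj mem_porbit. Qed.

Lemma eorbitX i e : eorbit ((f ^+ i)%g e) = eorbit e.
Proof. by apply/eqP; rewrite eq_eorbit mem_porbit. Qed.

Definition pullback (B : {set edge (quotient_graph h)}) : {set edge G} :=
  eorbit @^-1: B.

Lemma pullback_aut B : f @: pullback B = pullback B.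
Proof.
apply/setP=> e; rewrite -[e](permKV f) (mem_imset _ _ perm_inj) !inE.
by rewrite -[in RHS](expg1 f) eorbitX.
Qed.

Lemma eorbit_pullback B : eorbit @: pullback B = B.
Proof.
apply/setP=> O; have [e ->] := eorbitP O.
apply/imsetP/idP => [[e' + ->]|eB]; first by rewrite inE.
by exists e; rewrite ?inE.
Qed.

(** A stable set contains the whole orbit of each of its edges. *)
Lemma pullback_eorbit A : f @: A = A -> pullback (eorbit @: A) = A.
Proof.
move=> fA; apply/setP=> e; rewrite inE; apply/imsetP/idP => [[e' e'A]|eA].
  move/eqP; rewrite eq_eorbit => /porbitP[i ->].
  elim: i => [|i IHi]; first by rewrite perm1.
  by rewrite expgSr permM -fA imset_f.
by exists e.
Qed.

(** [pullback] and the image under [eorbit] are mutually inverse between stable edge sets and edge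
    sets of the quotient. *)
Lemma big_invariant (A0 : Type) (idx : A0) (op : Monoid.com_law idx) F :
  \big[op/idx]_(A : {set edge G} | imset_perm f A == A) F A
    = \big[op/idx]_(B : {set edge (quotient_graph h)}) F (pullback B).
Proof.
rewrite (reindex_onto pullback (fun A => eorbit @: A)) /= => [|A /eqP].
  by apply: eq_bigl => B; rewrite permE pullback_aut eorbit_pullback !eqxx.
by rewrite permE => /pullback_eorbit.
Qed.

(** * Components of a pullback *)

Section Pullback.
Variable B : {set edge (quotient_graph h)}.
Local Notation A := (pullback B).

Lemma connect_vproj u v :
  connect (adj A) u v -> connect (adj B) (vproj u) (vproj v).
Proof.
apply: homo_connect => {}u {}v /existsP[e /and3P[eA ue ve]].
apply/connect1/existsP; exists (eorbit e); rewrite inE in eA.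
by rewrite eA ends_eorbit !imset_f.
Qed.

(** Path lifting, one edge at a time. *)
Lemma connect_lift u y :
  connect (adj B) (vproj u) y -> exists2 w, vproj w = y & connect (adj A) u w.
Proof.
case/connectP=> s + ->; elim: s u => [|y' s IHs] u /=; first by exists u.
case/andP=> /existsP[O]; have [e ->] := eorbitP O; rewrite ends_eorbit.
case/and3P=> eB /imsetP[u' u'e uE] /imsetP[w' w'e ->].
(* The representative [e] ends at [u'], which is only in the orbit of [u]. Its translate by the
   [i]-th power of [h] ends at [u] itself, and the rest of the path is lifted from the translate of
   [w']. *)
have /porbitP[i ui] : u \in porbit g u' by rewrite -eq_vproj; apply/eqP.
rewrite -(vprojX i w') => /IHs[w wE cw]; exists w => //.
apply: connect_trans cw; apply/connect1/existsP; exists ((f ^+ i)%g e).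
by rewrite inE eorbitX eB ui !aut_incidenceX u'e.
Qed.

Lemma componentX i v : component A ((g ^+ i)%g v) = (g ^+ i)%g @: component A v.
Proof.
rewrite -imset_permX; elim: i => [|i IHi]; first by rewrite !expg0 !perm1.
by rewrite !expgSr !permM -IHi permE -component_aut pullback_aut.
Qed.

(** By path lifting, a vertex over the component of [vproj v] is a translate of a vertex connected
    to [v]; so the components over one component of the quotient form a single orbit. *)
Lemma eq_component_vproj v w :
  (component B (vproj w) == component B (vproj v))
    = (component A w \in porbit (imset_perm g) (component A v)).
Proof.
rewrite eq_sym -mem_component inE; apply/idP/porbitP => [|[i]].
  case/connect_lift=> w' /eqP; rewrite eq_sym eq_vproj => /porbitP[i ->] vw'.
  have /eqP vw'E : component A v == component A w' by rewrite -mem_component inE.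
  by exists i; rewrite imset_permX componentX vw'E.
rewrite imset_permX -componentX => /eqP; rewrite eq_sym -mem_component inE.
by move/connect_vproj; rewrite vprojX.
Qed.

End Pullback.
Variables (p : nat) (p_pr : prime p) (p_odd : odd p) (hper : periodic_by p h).

Lemma card_porbit_vert v : #|porbit g v| = p.
Proof.
case: hper => gp _ free; rewrite (card_porbit_prime v p_pr gp).
have := free v 1; rewrite expg1 => /(_ _)/negPf -> //.
by rewrite /= -subn1 subn_gt0 prime_gt1.
Qed.

(* An edge fixed by h would contain a full vertex orbit, of size p > 2. *)
Lemma card_porbit_edge e : #|porbit f e| = p.
Proof.
case: hper => _ fp _; rewrite (card_porbit_prime e p_pr fp).
case: eqP => // fe; have [u ue] := ends_witness e.
have : (#|porbit g u| <= #|ends e|)%N.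
  apply/subset_leq_card/subsetP=> _ /porbitP[i ->].
  elim: i => [|i IHi]; first by rewrite perm1.
  by rewrite expgSr permM -fe aut_incidence.
have := odd_prime_gt2 p_odd p_pr; have /andP[_ le2] := ends_card e.
by rewrite card_porbit_vert; lia.
Qed.

Lemma card_vproj_preim (D : {set vert (quotient_graph h)}) :
  #|vproj @^-1: D| = (#|D| * p)%N.
Proof.
apply: card_preimset_const => W _; have [v ->] := vprojP W.
rewrite -(card_porbit_vert v); apply: eq_card => u; rewrite inE.
exact: eq_vproj.
Qed.

Lemma card_pullback (B : {set edge (quotient_graph h)}) :
  #|pullback B| = (#|B| * p)%N.
Proof.
apply: card_preimset_const => O _; have [e ->] := eorbitP O.
rewrite -(card_porbit_edge e); apply: eq_card => e'; rewrite inE.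
exact: eq_eorbit.
Qed.

Lemma card_vert_quotient : (p * #|vert (quotient_graph h)|)%N = #|vert G|.
Proof.
have := card_vproj_preim setT.
by rewrite preimsetT !cardsT mulnC.
Qed.

(** * Counting in the fibre over a component of the quotient *)

Section Fiber.
Variables (B : {set edge (quotient_graph h)}) (v : vert G).
Local Notation A := (pullback B).
Local Notation Cbar := (component B (vproj v)).
Local Notation C0 := (component A v).
Local Notation orb := (porbit (imset_perm g) C0).

Lemma orbit_components C : (C \in components A) && (C \subset vproj @^-1: Cbar) = (C \in orb).
Proof.
apply/andP/idP => [[/componentsP[w ->]]|].
  move/subsetP/(_ _ (component_id A w)).
  by rewrite inE mem_component eq_sym eq_component_vproj.
move=> Co; have [w CE] : exists w, C = component A w.
  case/porbitP: Co => i ->; exists ((g ^+ i)%g v).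
  by rewrite imset_permX -componentX.
rewrite {C}CE -eq_component_vproj in Co *; split; first exact: component_in.
apply/subsetP=> u; rewrite inE => /connect_vproj wu.
by rewrite inE mem_component -(eqP Co) -mem_component inE.
Qed.

(** The closure hypothesis of [card_components_sum] and [card_inner_edges_sum] for the fibre. *)
Lemma component_sub_fiber w : w \in vproj @^-1: Cbar -> component A w \subset vproj @^-1: Cbar.
Proof.
rewrite inE mem_component eq_sym eq_component_vproj -orbit_components.
by case/andP.
Qed.

Lemma orbit_weight (R : comNzRingType) (x : nat -> R) z C :
  C \in orb -> weight x z A C = weight x z A C0.
Proof.
case/porbitP=> i ->; elim: i => [|i IHi]; first by rewrite perm1.
by rewrite expgSr permM permE -{1}(pullback_aut B) weight_aut.
Qed.

Lemma orbit_card C : C \in orb -> #|C| = #|C0|.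
Proof. by case/porbitP=> i ->; rewrite imset_permX card_imset //; apply: perm_inj. Qed.

Lemma orbit_card_inner C :
  C \in orb -> #|inner_edges A C| = #|inner_edges A C0|.
Proof.
case/porbitP=> i ->; elim: i => [|i IHi]; first by rewrite perm1.
rewrite expgSr permM permE -{1}(pullback_aut B) inner_edges_aut card_imset //.
exact: perm_inj.
Qed.

(** The vertices over [Cbar] are counted twice: by vertex orbits of size [p], and by components, all
    as large as [C0]. *)
Lemma card_fiber_vert : (#|Cbar| * p = #|orb| * #|C0|)%N.
Proof.
rewrite -card_vproj_preim (card_components_sum component_sub_fiber).
rewrite (eq_bigl (mem orb)) => [|C]; last exact: orbit_components.
by rewrite (eq_bigr (fun=> #|C0|)) ?sum_nat_const // => C /orbit_card.
Qed.

Lemma card_fiber_edge : (#|inner_edges B Cbar| * p = #|orb| * #|inner_edges A C0|)%N.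
Proof.
(* The edges of the pullback inside the fibre are the pullback of the edges of [B] inside [Cbar],
   and every edge orbit has [p] elements. *)
have -> : (#|inner_edges B Cbar| * p = #|inner_edges A (vproj @^-1: Cbar)|)%N.
  rewrite -card_pullback; apply: eq_card => e.
  rewrite !inE ends_eorbit; congr (_ && _); rewrite -sub_imset_pre.
  by apply: eq_subset => W; apply/imsetP/imsetP.
rewrite (card_inner_edges_sum component_sub_fiber).
rewrite (eq_bigl (mem orb)) => [|C]; last exact: orbit_components.
by rewrite (eq_bigr (fun=> #|inner_edges A C0|)) ?sum_nat_const // => C /orbit_card_inner.
Qed.

Lemma card_orbit_component : #|orb| = 1%N \/ #|orb| = p.
Proof.
case: hper => gp _ _; rewrite (card_porbit_prime _ p_pr (imset_perm_exp1 gp)).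
by case: ifP; [left | right].
Qed.

End Fiber.

Lemma image_component (B : {set edge (quotient_graph h)}) v :
  vproj @: component (pullback B) v = component B (vproj v).
Proof.
apply/setP=> y; rewrite inE; apply/imsetP/idP => [[w + ->]|].
  by rewrite inE => /connect_vproj.
by case/connect_lift=> w <- vw; exists w; rewrite ?inE.
Qed.

(** The image of a component of the pullback is a whole component of the quotient, so components can
    be grouped by image; lying over [D] already forces the image to be [D]. *)
Lemma prod_weight_fibers (R : comNzRingType) (x : nat -> R) z
    (B : {set edge (quotient_graph h)}) :
  \prod_(C in components (pullback B)) weight x z (pullback B) C =
  \prod_(D in components B)
    \prod_(C in components (pullback B) |
           C \subset vproj @^-1: D)
      weight x z (pullback B) C.
Proof.
rewrite (partition_big (fun C => vproj @: C) (mem (components B))); last first.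
  by move=> _ /componentsP[v ->]; rewrite image_component; apply: component_in.
apply: eq_bigr => _ /componentsP[W ->]; have [v ->] := vprojP W.
apply: eq_bigl => C; case: (boolP (C \in _)) => // /componentsP[w ->].
rewrite !andTb image_component -sub_imset_pre image_component.
apply/eqP/subsetP => [-> //|/(_ _ (component_id B (vproj w)))].
by rewrite mem_component => /eqP.
Qed.

End Automorphism.

(** * The congruence over one component, and the final assembly *)

(** Frobenius gives y^p + (-1)^p, the sign is -1 because [p] is odd, and y^p - y is a generator. *)
Lemma relations_yvarB1 p n : prime p -> odd p ->
  congr_mod (@relations p n) ((yvar n - 1) ^+ p) (yvar n - 1).
Proof.
move=> p_pr p_odd.
have Sp : @relations p n p%:R by constructor 1.
apply: congr_trans (congr_exprD _ _ p_pr Sp) _.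
rewrite -signr_odd p_odd expr1.
apply: congrD; last exact: congr_refl.
by apply: in_ideal_gen; constructor 2.
Qed.

Lemma congr_fiber (G : mgraph) (h : automorphism G) p : prime p -> odd p ->
    periodic_by p h -> forall B D, D \in components B ->
  congr_mod (@relations p #|vert G|)
    (\prod_(C in components (pullback B) | C \subset @vproj G h @^-1: D)
      weight (xvar #|vert G|) (yvar #|vert G| - 1) (pullback B) C)
    (weight (xvar #|vert G|) (yvar #|vert G| - 1) B D).
Proof.
move=> p_pr p_odd hper B _ /componentsP[W ->]; have [v ->] := vprojP W.
set n := #|vert G|; set z := yvar n - 1.
have zp := relations_yvarB1 n p_pr p_odd; rewrite -/z in zp.
have p1 := prime_gt1 p_pr.
rewrite (eq_bigl _ _ (@orbit_components G h B v)).
(* Weights agree along the orbit, so the product is a power whose exponent is the orbit size. *)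
rewrite (eq_bigr _ (@orbit_weight G h B v _ (xvar n) z)) prodr_const.
have := card_fiber_vert p_pr hper B v; have := card_fiber_edge p_pr p_odd hper B v.
have := card_component_le (pullback B) v; have := card_component_le B (vproj h v).
rewrite /weight.
have c0 : (0 < #|component B (vproj h v)|)%N.
  by apply/card_gt0P; exists (vproj h v); apply: component_id.
(* Keeps the indices c and pc within 1, ..., [n], as the generators in [relations] demand. *)
have cn : (p * #|component B (vproj h v)| <= n)%N.
  by rewrite /n -(card_vert_quotient p_pr hper) leq_mul2l max_card orbT.
set c := #|component B _| in c0 cn *; set e := #|inner_edges B _|.
set c' := #|component _ _|; set e' := #|inner_edges _ _| => lece lece'.
case: (card_orbit_component p_pr hper B v) => -> eE cE.
  rewrite !mul1n in eE cE; rewrite -{}eE -{}cE expr1 in lece' *.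
  (* A single invariant component: [card_component_le] in the pullback reads pc <= pe + 1, and p > 1
     then excludes c = e + 1. *)
  have {lece'}lece' : (c <= e)%N by nia.
  apply: congrM.
    rewrite mulnC; apply: in_ideal_gen; constructor 4; exists c => //.
    by rewrite c0.
  (* The exponents are p(e - c) + 1 and (e - c) + 1; splitting off one factor [z] leaves (z^p)^(e -
     c) against z^(e - c). *)
  rewrite !subSn ?leq_mul2r ?lece' ?orbT // !exprS -mulnBl.
  rewrite mulnC exprM; apply: congrM; [exact: congr_refl | exact: congrX].
(* Orbit of size [p]: cancelling [p] in both counts gives e' = e and c' = c, so the [p]-th power of
   a weight is to be reduced to that weight. *)
have p0 : (0 < p)%N by apply: ltnW.
move/eqP: eE; rewrite mulnC eqn_pmul2l // => /eqP <-.
move/eqP: cE; rewrite mulnC eqn_pmul2l // => /eqP <-.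
rewrite exprMn; apply: congrM.
  apply: in_ideal_gen; constructor 3; exists c => //.
  by rewrite c0 (leq_trans _ cn) // leq_pmull.
by rewrite -exprM mulnC exprM; apply: congrX.
Qed.

Theorem theorem3p1 (p : nat) (hp : prime p) (hodd : odd p)
    (G : mgraph) (h : automorphism G) (hper : periodic_by p h) :
  let n := #|vert G| in
  let Gbar := quotient_graph h in
  (p * #|vert Gbar|)%N = n /\
  in_ideal (@relations p n) (U G - incl n (U Gbar)).
Proof.
move=> n Gbar; split; first exact: card_vert_quotient hp hper.
rewrite incl_U U_weight -/(congr_mod _ _ _).
have [_ fp _] := hper.
have Sp : @relations p n p%:R by constructor 1.
(* Edge sets moved by [h] cancel modulo [p]; the stable ones remain, and they are the pullbacks. *)
apply: congr_trans (congr_sum_fixed hp (imset_perm_exp1 fp) Sp _) _ => [A|].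
  by rewrite permE prod_weight_aut.
rewrite big_invariant; apply: congr_sum => B _.
rewrite prod_weight_fibers; apply: congr_prod => D DB.
exact: congr_fiber.
Qed.
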